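(* Let $X$ be a random vector with arbitrary support and let $Y$ have finite support $\{y_0,\dots,y_K\}$, $K\ge1$. Choose $J+1\ge2$ different values $x_0,\dots,x_J$ of $X$, and for each $j=0,\dots,J$ draw an independent sample $Y_{j1},\dots,Y_{jn_j}$ $(n_j\ge1)$ from the conditional distribution of $Y$ given $X=x_j$, the $J+1$ subsamples being independent. Put $R_{jk}=\#\{i: Y_{ji}=y_k\}$, and let the conditional probabilities $\pi_{jk|X}=P\{Y=y_k\mid X=x_j\}>0$ satisfy the multivariate linear logistic regression model $$\log\frac{\pi_{jk|X}}{\pi_{j0|X}}=\gamma_k+z_{jk}^T\vec\theta,\qquad j=0,\dots,J,\ k=1,\dots,K,$$ with known covariates $z_{jk}\in\mathbb R^L$ satisfying $z_{j0}=z_{0k}=0$ for all $j,k$, and parameter $\lambda=(\gamma,\vec\theta)$, $\gamma=(\gamma_1,\dots,\gamma_K)\in\mathbb R^K$, $\vec\theta\in\mathbb R^L$. Let $$\log L_{Y|X}(\lambda)=\sum_{j=0}^J\sum_{k=0}^K R_{jk}\log\pi_{jk|X}$$ be the log-likelihood and $U(\lambda)$ the score vector, i.e. the gradient of $\log L_{Y|X}$ with respect to $\lambda$. Then the inverse of the covariance matrix of the score vector (under the parameter value $\lambda$) is $$\mathrm{Cov}(U(\lambda))^{-1}=\Sigma_{\hat\lambda},\qquad\text{where}\quad \Sigma_{\hat\lambda}=\begin{pmatrix} B^T\\ (Z^{\circ})^{-}C^T\end{pmatrix}\,[P^D_{\mathscr H}-P^D_{\mathscr R}]\,D^{-1}\begin{pmatrix}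 B, & C\,(Z^{\circ})^{-T}\end{pmatrix}.$$
   Context: $I=(J+1)(K+1)$. Tables $a=(a_{jk})$, $0\le j\le J$, $0\le k\le K$, are identified with vectors $\vec a\in\mathbb R^I$ by stacking columns; $\vec e_{jk}\in\mathbb R^I$ is the unit vector of the table with a one at position $(j,k)$ and zeros elsewhere, and $\vec e_{j+}=\sum_k\vec e_{jk}$, $\vec e_{+k}=\sum_j\vec e_{jk}$. Tables indexed by $j,k>0$ are vectorized likewise in $\mathbb R^{JK}$. $\mu_{jk}=n_j\pi_{jk|X}=\mathbb E(R_{jk})$ and $D=\mathrm{diag}\{\vec\mu\}$. $\mathscr R=\mathrm{span}\{\vec e_{0+},\dots,\vec e_{J+}\}$. $\mathscr H\subset\mathbb R^I$ is the linear space of all $\vec\eta$ with $\eta_{jk}=\alpha+\rho_j+\gamma_k+z_{jk}^T\vec\theta$, where $\alpha\in\mathbb R$, $\rho_0=\gamma_0=0$, $\rho_j,\gamma_k\in\mathbb R$ $(j,k>0)$ and $\vec\theta\in\mathbb R^L$ are arbitrary. For a subspace $\mathscr M\subset\mathbb R^I$, $P^D_{\mathscr M}$ is the matrix of the orthogonal projection onto $\mathscr M$ with respect to the inner product $\langle a,b\rangle_D=a^TDb$. $Z^\circ$ is the $JK\times L$ matrix with rows $z_{jk}^T$, $j,k>0$, assumed to have rank $L$; $(Z^\circ)^-=((Z^\circ)^TZ^\circ)^{-1}(Z^\circ)^T$ and $(Z^\circ)^{-T}$ is the transpose of $(Z^\circ)^-$. $C$ is the $I\times JK$ matrix with columns $c_{jk}=\vec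 e_{jk}+\vec e_{00}-\vec e_{j0}-\vec e_{0k}$, $j,k>0$ (ordered as the rows of $Z^\circ$), and $B$ is the $I\times K$ matrix with columns $b_k=\vec e_{0k}-\vec e_{00}$, $k=1,\dots,K$. The matrix $\Sigma_{\hat\lambda}$ is the asymptotic covariance matrix of the maximum likelihood estimator $\hat\lambda$ in the log-linear contingency table model $\log\vec\mu\in\mathscr H$ in which $X$ has finite support $\{x_0,\dots,x_J\}$ and the rows of the table of counts are independent multinomial (sampling conditional on $X$). *)

(* Defs.v *)
From HB Require Import structures.
From mathcomp Require Import all_boot all_order all_algebra.
From mathcomp Require Import all_classical all_reals all_analysis.

Set Implicit Arguments.
Unset Strict Implicit.
Unset Printing Implicit Defensive.

Import Order.TTheory GRing.Theory Num.Theory.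
Import numFieldNormedType.Exports.

Local Open Scope classical_set_scope.
Local Open Scope ring_scope.

Section Tables.
Variable R : realType.

(* Columns are stacked: [mxvec] concatenates rows, hence the transposition.
   The entry (j, k) of the table is at position [mxvec_index k j]. *)
Definition vec (m n : nat) (a : 'M[R]_(m, n)) : 'cV[R]_(n * m) := (mxvec a^T)^T.

Variables J K L : nat.

Definition e_ (j : 'I_J.+1) (k : 'I_K.+1) : 'cV[R]_(K.+1 * J.+1) :=
  vec (delta_mx j k).
Definition e_row (j : 'I_J.+1) : 'cV[R]_(K.+1 * J.+1) := \sum_k e_ j k.

Definition Rspace : set 'cV[R]_(K.+1 * J.+1) :=
  [set v | v \in <<[seq e_row j | j : 'I_J.+1]>>%VS].

(* [z j k] is the covariate vector z_jk, as a column. *)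
Variable z : 'I_J.+1 -> 'I_K.+1 -> 'cV[R]_L.

Definition Hspace : set 'cV[R]_(K.+1 * J.+1) :=
  [set eta | exists (alpha : R) (rho : 'I_J.+1 -> R) (gamma : 'I_K.+1 -> R)
      (theta : 'cV[R]_L),
    [/\ rho ord0 = 0, gamma ord0 = 0 &
     eta = vec (\matrix_(j, k)
       (alpha + rho j + gamma k + ((z j k)^T *m theta) 0 0))]].

(* An index j > 0 (resp. k > 0) is [lift ord0 j] with j : 'I_J (resp. 'I_K).
   The l-th column of [Zo] is the vectorized table of the l-th components of
   the z_jk, so its row at the position of (j, k) is z_jk^T. *)
Definition Zo : 'M[R]_(K * J, L) :=
  \matrix_(i, l) vec (\matrix_(j < J, k < K)
    z (lift ord0 j) (lift ord0 k) l 0) i 0.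

Definition Zo_minus : 'M[R]_(L, K * J) := invmx (Zo^T *m Zo) *m Zo^T.

Definition c_ (j : 'I_J) (k : 'I_K) : 'cV[R]_(K.+1 * J.+1) :=
  e_ (lift ord0 j) (lift ord0 k) + e_ ord0 ord0
  - e_ (lift ord0 j) ord0 - e_ ord0 (lift ord0 k).

(* The column of [Cmx] at the position of (j, k) is c_jk. *)
Definition Cmx : 'M[R]_(K.+1 * J.+1, K * J) :=
  \matrix_(i, q) vec (\matrix_(j < J, k < K) c_ j k i 0) q 0.

Definition Bmx : 'M[R]_(K.+1 * J.+1, K) :=
  \matrix_(i, k) (e_ ord0 (lift ord0 k) - e_ ord0 ord0) i 0.

End Tables.


(* P is the matrix of the orthogonal projection onto M with respect to the
   inner product <a, b>_D = a^T D b. *)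
Definition is_orth_proj (R : realType) (N : nat) (D : 'M[R]_N)
    (M : set 'cV[R]_N) (P : 'M[R]_N) : Prop :=
  forall v : 'cV[R]_N, M (P *m v) /\
    forall m : 'cV[R]_N, M m -> m^T *m D *m (v - P *m v) = 0.

(* For D positive definite and M a linear subspace there is exactly one such
   matrix, so neither the choice nor the default value 0 matters. *)
Definition orth_proj (R : realType) (N : nat) (D : 'M[R]_N)
    (M : set 'cV[R]_N) : 'M[R]_N :=
  xget 0 [set P | is_orth_proj D M P].

Definition Sigma_lambda (R : realType) (J K L : nat)
    (z : 'I_J.+1 -> 'I_K.+1 -> 'cV[R]_L) (mu : 'M[R]_(J.+1, K.+1)) :
    'M[R]_(K + L) :=
  let D := diag_mx (vec mu)^T in
  col_mx (Bmx R J K)^T (Zo_minus z *m (Cmx R J K)^T)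
    *m (orth_proj D (Hspace z) - orth_proj D (@Rspace R J K))
    *m invmx D
    *m row_mx (Bmx R J K) (Cmx R J K *m (Zo_minus z)^T).


(* The parameter is lambda = (gamma, theta), with gamma = [usubmx lambda] and
   theta = [dsubmx lambda]; gamma_k, k > 0, is indexed by k : 'I_K.
   [pi lambda j k] is pi_{jk|X} under the parameter value lambda. *)
Definition logit_model (R : realType) (J K L : nat)
    (z : 'I_J.+1 -> 'I_K.+1 -> 'cV[R]_L)
    (pi : 'cV[R]_(K + L) -> 'I_J.+1 -> 'I_K.+1 -> R) : Prop :=
  forall (lambda : 'cV[R]_(K + L)) (j : 'I_J.+1),
    [/\ forall k, 0 < pi lambda j k,
        \sum_k pi lambda j k = 1 &
        forall k : 'I_K,
          ln (pi lambda j (lift ord0 k) / pi lambda j ord0) =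
          usubmx lambda k 0 + ((z j (lift ord0 k))^T *m dsubmx lambda) 0 0].

Definition log_lik (R : realType) (J K M : nat)
    (pi : 'cV[R]_M -> 'I_J.+1 -> 'I_K.+1 -> R)
    (r : 'I_J.+1 -> 'I_K.+1 -> nat) (lambda : 'cV[R]_M) : R :=
  \sum_(j < J.+1) \sum_(k < K.+1) (r j k)%:R * ln (pi lambda j k).

Definition gradient (R : realType) (M : nat) (f : 'cV[R]_M -> R)
    (a : 'cV[R]_M) : 'cV[R]_M :=
  \col_i 'D_(delta_mx i 0) f a.

Section Probability.
Local Open Scope ereal_scope.

(* x is in the (topological) support of the distribution of X. *)
Definition in_support (R : realType) (d : measure_display)
    (T : measurableType d) (P : probability T R) (p : nat)
    (X : T -> p.-tuple R) (x : p.-tuple R) : Prop :=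
  forall e : R, (0 < e)%R ->
    0 < P [set w | forall i, (`|tnth (X w) i - tnth x i| < e)%R].

Definition has_finite_support (R : realType) (d dU : measure_display)
    (T : measurableType d) (U : measurableType dU) (P : probability T R)
    (Y : T -> U) (K : nat) (y : 'I_K.+1 -> U) : Prop :=
  [/\ injective y, forall k, measurable [set y k],
      forall k, 0 < P (Y @^-1` [set y k]) & P (Y @^-1` range y) = 1].

(* kappa is a regular conditional distribution of Y given X, i.e. kappa (X w) B
   is a version of the conditional probability of Y in B given X. *)
Definition cond_distribution (R : realType) (d dV dU : measure_display)
    (T : measurableType d) (V : measurableType dV) (U : measurableType dU)
    (P : probability T R) (X : T -> V) (Y : T -> U)
    (kappa : R.-pker V ~> U) : Prop :=
  forall (A : set V) (B : set U), measurable A -> measurable B ->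
    P (X @^-1` A `&` Y @^-1` B) = \int[P]_(w in X @^-1` A) kappa (X w) B.

Definition mutually_independent (R : realType) (d dU : measure_display)
    (T : measurableType d) (U : measurableType dU) (P : probability T R)
    (I : finType) (Y : I -> T -> U) : Prop :=
  forall (A : {set I}) (B : I -> set U), (forall i, measurable (B i)) ->
    P (\bigcap_(i in [set` A]) Y i @^-1` B i) =
    \prod_(i in A) P (Y i @^-1` B i).

Definition cov_mx (R : realType) (d : measure_display) (T : measurableType d)
    (P : probability T R) (M : nat) (U : T -> 'cV[R]_M) : 'M[R]_M :=
  \matrix_(i, j)
    fine (covariance P (fun w => U w i ord0) (fun w => U w j ord0)).

End Probability.

Definition counts (T U : Type) (J K : nat) (n : 'I_J.+1 -> nat)
    (y : 'I_K.+1 -> U) (Ys : forall j : 'I_J.+1, 'I_(n j) -> T -> U) (w : T)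
    (j : 'I_J.+1) (k : 'I_K.+1) : nat :=
  #|[set i : 'I_(n j) | `[< Ys j i w = y k >]]|.

(* Main.v *)
(* With a_jk the vector of derivatives of the logit of (j, k) and
   g_jk = a_jk - sum_l pi_jl a_jl, the score is sum_jk R_jk g_jk.  As the
   samples are independent and sum_k pi_jk g_jk = 0, only the diagonal terms
   survive in its covariance, which is G^T D G, where G has the rows g_jk^T.
   The columns of G span the D-orthogonal complement of the row space in H,
   hence P_H - P_R = G (G^T D G)^-1 G^T D.  Finally W = (B, C Zo^-T) satisfies
   W^T G = 1, since the columns of B and C are contrasts within rows, so that
   W^T (P_H - P_R) D^-1 W collapses to (G^T D G)^-1. *)

Require Import Defs.
From HB Require Import structures.
From mathcomp Require Import all_boot all_order all_algebra.
From mathcomp Require Import all_classical all_reals all_analysis.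

Import Order.TTheory GRing.Theory Num.Theory.
Import numFieldNormedType.Exports.

Local Open Scope classical_set_scope.
Local Open Scope ring_scope.

Set Implicit Arguments.
Unset Strict Implicit.
Unset Printing Implicit Defensive.

(** * Orthogonal projections with respect to a definite bilinear form *)

Section OrthogonalProjection.
Variables (R : realType) (N : nat) (D : 'M[R]_N).
Hypothesis D_def : forall v : 'cV[R]_N, v^T *m D *m v = 0 -> v = 0.

(** The vector Pv - Qv is a difference of two residuals, each [D]-orthogonal to [M], while Pv and Qv
    themselves lie in [M]. Hence Pv - Qv is [D]-orthogonal to itself, and definiteness makes it
    zero. *)
Lemma is_orth_proj_unique (M : set 'cV[R]_N) (P Q : 'M[R]_N) :
  is_orth_proj D M P -> is_orth_proj D M Q -> P = Q.
Proof.
move=> hP hQ; suff PQ (v : 'cV[R]_N) : P *m v = Q *m v.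
  by apply/matrixP => i j; have /matrixP/(_ i 0) := PQ (delta_mx j 0);
    rewrite -!colE !mxE.
have [MP oP] := hP v; have [MQ oQ] := hQ v.
apply/eqP; rewrite -subr_eq0; apply/eqP/D_def.
have PQE : P *m v - Q *m v = (v - Q *m v) - (v - P *m v).
  by rewrite opprB [RHS]addrC subrKA.
have oPQ m : M m -> m^T *m D *m (P *m v - Q *m v) = 0.
  by move=> Mm; rewrite PQE mulmxBr oP// oQ// subrr.
by rewrite [X in X *m D]linearB/= -mulmxA mulmxBl !mulmxA oPQ// oPQ// subrr.
Qed.

Lemma orth_projE (M : set 'cV[R]_N) (P : 'M[R]_N) :
  is_orth_proj D M P -> orth_proj D M = P.
Proof.
by move=> hP; apply: is_orth_proj_unique (hP); apply: xgetPex; exists P.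
Qed.

(** The weighted least squares hat matrix: the projection onto the column space of [X], provided
    that the Gram matrix is invertible. *)
Definition proj_mx (m : nat) (X : 'M[R]_(N, m)) : 'M[R]_N :=
  X *m invmx (X^T *m D *m X) *m X^T *m D.

Lemma proj_mx_orth (m : nat) (X : 'M[R]_(N, m)) (v : 'cV[R]_N) :
  X^T *m D *m X \in unitmx -> X^T *m D *m (v - proj_mx X *m v) = 0.
Proof.
by move=> Xu; rewrite mulmxBr /proj_mx !mulmxA mulmxV// mul1mx subrr.
Qed.

(** If a row u kills the Gram matrix, then X u^T is [D]-orthogonal to itself, so it vanishes, and
    injectivity of [X] gives u = 0. *)
Lemma gram_unitmx (m : nat) (X : 'M[R]_(N, m)) :
  (forall u : 'cV[R]_m, X *m u = 0 -> u = 0) -> X^T *m D *m X \in unitmx.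
Proof.
move=> X_inj; rewrite -row_free_unit; apply: inj_row_free => u uS.
apply: trmx_inj; rewrite trmx0; apply/X_inj/D_def.
by rewrite trmx_mul trmxK !mulmxA -[u *m _ *m D]mulmxA -[u *m _ *m X]mulmxA uS
  mul0mx.
Qed.

Lemma is_orth_proj_proj_mx (m : nat) (X : 'M[R]_(N, m)) :
  X^T *m D *m X \in unitmx ->
  is_orth_proj D [set v | exists u, v = X *m u] (proj_mx X).
Proof.
move=> Xu v; split=> [|_ [u ->]].
  by exists (invmx (X^T *m D *m X) *m X^T *m D *m v); rewrite !mulmxA.
by rewrite trmx_mul -(mulmxA _ X^T) -mulmxA proj_mx_orth// mulmx0.
Qed.

(** Each projection kills the columns of the other matrix, so the residual of the sum is orthogonal
    to both column spaces. Orthogonality is asked in both orders because [D] is not assumed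
    symmetric. *)
Lemma is_orth_proj_add (m p : nat) (X : 'M[R]_(N, m)) (Y : 'M[R]_(N, p)) :
  X^T *m D *m X \in unitmx -> Y^T *m D *m Y \in unitmx ->
  X^T *m D *m Y = 0 -> Y^T *m D *m X = 0 ->
  is_orth_proj D [set v | exists u w, v = X *m u + Y *m w]
    (proj_mx X + proj_mx Y).
Proof.
move=> Xu Yu XY YX v; rewrite mulmxDl; split=> [|_ [u [w ->]]].
  exists (invmx (X^T *m D *m X) *m X^T *m D *m v).
  by exists (invmx (Y^T *m D *m Y) *m Y^T *m D *m v); rewrite !mulmxA.
have XE : X^T *m D *m (v - (proj_mx X *m v + proj_mx Y *m v)) = 0.
  rewrite opprD addrA mulmxBr proj_mx_orth//.
  by rewrite /proj_mx !mulmxA XY !mul0mx subrr.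
have YE : Y^T *m D *m (v - (proj_mx X *m v + proj_mx Y *m v)) = 0.
  rewrite [_ *m v + _]addrC opprD addrA mulmxBr proj_mx_orth//.
  by rewrite /proj_mx !mulmxA YX !mul0mx subrr.
rewrite [X in X *m D]linearD/= !trmx_mul !mulmxDl.
rewrite -(mulmxA _ X^T) -(mulmxA _ Y^T).
by rewrite -!(mulmxA _ (_^T *m D)) XE YE !mulmx0 addr0.
Qed.
End OrthogonalProjection.

Lemma diag_mx_definite (R : realType) (N : nat) (a : 'rV[R]_N) :
  (forall i, 0 < a 0 i) ->
  forall v : 'cV[R]_N, v^T *m diag_mx a *m v = 0 -> v = 0.
Proof.
move=> a_gt0 v /matrixP/(_ 0 0); rewrite mul_mx_diag mxE [RHS]mxE.
move=> /eqP; rewrite psumr_eq0 => [/allP v0|i _]; last first.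
  by rewrite !mxE mulrAC -expr2 mulr_ge0 ?sqr_ge0// ltW.
apply/colP => i; have /implyP/(_ isT) := v0 i (mem_index_enum i).
by rewrite !mxE mulrAC -expr2 mulf_eq0 sqrf_eq0 (gt_eqF (a_gt0 i)) orbF => /eqP.
Qed.

(** * Matrices whose rows are indexed by table positions *)

Section Tables.
Variable R : realType.

Lemma vecE (m n : nat) (a : 'M[R]_(m, n)) j k i :
  vec a (mxvec_index k j) i = a j k.
Proof. by rewrite /vec mxE ord1 mxvecE mxE. Qed.

Lemma sum_mxvec_index (V : nmodType) (m n : nat) (F : 'I_(n * m) -> V) :
  \sum_i F i = \sum_(j < m) \sum_(k < n) F (mxvec_index k j).
Proof.
rewrite (reindex _ (curry_mxvec_bij n m)) exchange_big pair_big/=.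
by apply: eq_bigr => -[].
Qed.

(** The common shape of [Zo] and of the design matrices [E] and [G]: the row at the position of (j,
    k) is the transpose of [f j k]. *)
Definition rows_mx (m n p : nat) (f : 'I_m -> 'I_n -> 'cV[R]_p) :
    'M[R]_(n * m, p) :=
  \matrix_(i, l) vec (\matrix_(j, k) f j k l 0) i 0.

Lemma rows_mxE (m n p : nat) (f : 'I_m -> 'I_n -> 'cV[R]_p) j k l :
  rows_mx f (mxvec_index k j) l = f j k l 0.
Proof. by rewrite mxE vecE mxE. Qed.

(** Writing a weighted Gram matrix as a sum of outer products allows orthogonality to be checked one
    table row at a time, and is the form in which the covariance of the score appears. *)
Lemma rows_mx_gram (m n p q : nat) (f : 'I_m -> 'I_n -> 'cV[R]_p)
    (g : 'I_m -> 'I_n -> 'cV[R]_q) (mu : 'M[R]_(m, n)) :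
  (rows_mx f)^T *m diag_mx (vec mu)^T *m rows_mx g =
  \sum_j \sum_k mu j k *: (f j k *m (g j k)^T).
Proof.
rewrite mul_mx_diag; apply/matrixP => s t; rewrite mxE sum_mxvec_index summxE.
apply: eq_bigr => j _; rewrite summxE; apply: eq_bigr => k _.
rewrite [in LHS]mxE [X in X * _ * _]mxE [X in _ * X * _]mxE vecE !rows_mxE.
rewrite [X in X * _]mulrC -mulrA [RHS]mxE; congr (_ * _).
by rewrite mxE big_ord1 [X in _ = _ * X]mxE.
Qed.
End Tables.

(** * The score of the logistic model *)

Lemma derive_line (R : realType) (M : nat) (f : 'cV[R]_M -> R) lambda v :
  'D_v f lambda = 'D_1 (fun h : R => f (h *: v + lambda)) 0.
Proof.
rewrite /derive.
have -> // : (fun h : R => h^-1 *: ((f \o shift lambda) (h *: v) - f lambda)) =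
  fun h : R => h^-1 *: (((fun h : R => f (h *: v + lambda)) \o shift 0) (h *: 1)
    - f (0 *: v + lambda)).
by apply/funext => h /=; rewrite scale0r add0r addr0 [h *: 1]mulr1.
Qed.

Lemma sum_expR_gt0 (R : realType) (n : nat) (c : 'I_n.+1 -> R) :
  0 < \sum_i expR (c i).
Proof.
by rewrite big_ord_recl ltr_pwDl ?expR_gt0// sumr_ge0// => i _; exact: expR_ge0.
Qed.

(** The derivative of a log-partition function is the mean of the slopes [b] under the softmax
    weights of [c]. *)
Lemma is_derive_log_sum_exp (R : realType) (n : nat) (c b : 'I_n.+1 -> R) :
  is_derive (0 : R) 1 (fun h : R => ln (\sum_i expR (c i + h * b i)))
    ((\sum_i expR (c i) * b i) / \sum_i expR (c i)).
Proof.
have dS : is_derive (0 : R) 1 (fun h : R => \sum_i expR (c i + h * b i))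
    (\sum_i expR (c i) * b i).
  rewrite (_ : (fun h : R => _) =
    \sum_i (expR \o (cst (c i) + (b i \*: id)))); last first.
    apply/funext => h; rewrite fct_sumE; apply: eq_bigr => i _.
    by rewrite /= mulrC.
  apply: is_derive_sum => i.
  have dl : is_derive (0 : R) 1 (cst (c i) + (b i \*: id)) (b i).
    have := is_deriveD (is_derive_cst (c i) (0 : R) 1)
      (is_deriveZ (b i) (is_derive_id (0 : R) 1)).
    by rewrite add0r [_ *: 1]mulr1.
  have := is_derive1_comp (is_derive_expR _) dl.
  by rewrite [X in expR X * _](_ : _ = c i) //= /GRing.add/= scaler0 addr0.
rewrite mulrC; apply: (@is_derive1_comp R (@ln R)).
suff -> : \sum_i expR (c i + 0 * b i) = \sum_i expR (c i)
  by exact/is_derive1_ln/sum_expR_gt0.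
by apply: eq_bigr => i _; rewrite mul0r addr0.
Qed.

Section Score.
Variables (R : realType) (J K L : nat) (z : 'I_J.+1 -> 'I_K.+1 -> 'cV[R]_L).

(** The vector a_jk of the overview. Its upper block is the indicator of category k and vanishes for
    the baseline category, so the logit is linear in [lambda] for all k, including k = 0. *)
Definition covariate (j : 'I_J.+1) (k : 'I_K.+1) : 'cV[R]_(K + L) :=
  col_mx (\col_i (k == lift ord0 i)%:R) (z j k).

Definition logit (lambda : 'cV[R]_(K + L)) j k : R :=
  ((covariate j k)^T *m lambda) 0 0.

Variable pi : 'cV[R]_(K + L) -> 'I_J.+1 -> 'I_K.+1 -> R.
Hypothesis hpi : logit_model z pi.
Hypothesis hz_col : forall j, z j ord0 = 0.

Lemma logit0 lambda j : logit lambda j ord0 = 0.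
Proof.
rewrite /logit /covariate hz_col (_ : \col_i _ = 0).
  by rewrite col_mx0 trmx0 mul0mx mxE.
by apply/colP => i; rewrite !mxE.
Qed.

Lemma logit_lift lambda j k : logit lambda j (lift ord0 k) =
  usubmx lambda k 0 + ((z j (lift ord0 k))^T *m dsubmx lambda) 0 0.
Proof.
rewrite /logit /covariate -[in LHS](vsubmxK lambda) tr_col_mx mul_row_col mxE.
congr (_ + _); rewrite mxE (bigD1 k)//= big1 ?addr0 ?mxE ?eqxx ?mul1r//.
by move=> i ik; rewrite 2!mxE (inj_eq lift_inj) eq_sym (negbTE ik) mul0r.
Qed.

(** Every probability is the baseline one times the exponential of its logit; that they sum to 1
    then fixes the baseline. *)
Lemma logit_modelE lambda j k :
  pi lambda j k = expR (logit lambda j k) / \sum_l expR (logit lambda j l).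
Proof.
have [pi0 pi1 piE] := hpi lambda j.
have piexp l : pi lambda j l = pi lambda j ord0 * expR (logit lambda j l).
  have [k' ->|->] := unliftP ord0 l; last by rewrite logit0 expR0 mulr1.
  rewrite logit_lift -piE lnK ?posrE ?divr_gt0 // mulrCA mulfV ?mulr1 //.
  exact: lt0r_neq0.
have S0 : \sum_l expR (logit lambda j l) != 0 by rewrite gt_eqF ?sum_expR_gt0.
apply: (mulIf S0); rewrite divfK // piexp mulrAC mulr_sumr.
by rewrite -(eq_bigr _ (fun l _ => piexp l)) pi1 mul1r.
Qed.

Lemma gradient_log_lik (r : 'I_J.+1 -> 'I_K.+1 -> nat) lambda :
  gradient (log_lik pi r) lambda =
  \sum_j \sum_k (r j k)%:R *:
    (covariate j k - \sum_l pi lambda j l *: covariate j l).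
Proof.
(* On the line through [lambda] in the direction of coordinate m, each logit is affine in h with
   slope [b j k], so one-variable calculus applies. *)
apply/colP => m; rewrite mxE derive_line.
pose b j k := covariate j k m 0.
have logitD h j k : logit (h *: delta_mx m 0 + lambda) j k =
    logit lambda j k + h * b j k.
  rewrite /logit mulmxDr -scalemxAr -colE addrC mxE; congr (_ + _).
  by rewrite mxE; congr (_ * _); rewrite mxE [LHS]mxE.
transitivity (\sum_j \sum_k (r j k)%:R *
    (b j k - (\sum_l expR (logit lambda j l) * b j l) /
             \sum_l expR (logit lambda j l))).
  rewrite /log_lik.
  (* A log-probability is an affine function minus a log-sum-exp; the point-free form lets the
     derivative rules be composed. *)
  rewrite (_ : (fun h : R => _) = \sum_j \sum_k ((r j k)%:R \*:
     (cst (logit lambda j k) + b j k \*: id -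
      (fun h : R => ln (\sum_l expR (logit lambda j l + h * b j l))))));
    last first.
    apply/funext => h; rewrite fct_sumE; apply: eq_bigr => j _.
    rewrite fct_sumE; apply: eq_bigr => k _.
    rewrite logit_modelE ln_div ?posrE ?expR_gt0 ?sum_expR_gt0//.
    rewrite expRK /= logitD; congr (_ * (_ + _ - _)); first by rewrite mulrC.
    by congr ln; apply: eq_bigr => l _; rewrite logitD.
  have d j k : is_derive (0 : R) 1
      (cst (logit lambda j k) + b j k \*: id) (b j k).
    have := is_deriveD (is_derive_cst (logit lambda j k) (0 : R) 1)
      (is_deriveZ (b j k) (is_derive_id (0 : R) 1)).
    by rewrite add0r [_ *: 1]mulr1.
  have D := is_derive_sum (fun j => is_derive_sum (fun k =>
    is_deriveZ (r j k)%:R (is_deriveB (d j k)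
      (is_derive_log_sum_exp (logit lambda j) (b j))))).
  by rewrite (@derive_val _ _ _ _ _ _ _ D).
rewrite summxE; apply: eq_bigr => j _; rewrite summxE; apply: eq_bigr => k _.
rewrite mxE; congr (_ * _); rewrite mxE; congr (_ + _).
rewrite mxE; congr (- _).
rewrite summxE mulr_suml; apply: eq_bigr => l _.
by rewrite mxE logit_modelE mulrAC.
Qed.
End Score.

(** * The contrasts [Bmx] and [Cmx] applied to design matrices *)

Section TableContrasts.
Variable R : realType.

Lemma e_delta (J K : nat) (j : 'I_J.+1) (k : 'I_K.+1) :
  e_ R j k = delta_mx (mxvec_index k j) 0.
Proof. by rewrite /e_ /vec trmx_delta mxvec_delta trmx_delta. Qed.

Lemma tr_e_mul (J K p : nat) (f : 'I_J.+1 -> 'I_K.+1 -> 'cV[R]_p) j k :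
  (e_ R j k)^T *m rows_mx f = (f j k)^T.
Proof.
rewrite e_delta trmx_delta -rowE; apply/rowP => l.
by rewrite mxE rows_mxE mxE.
Qed.

Lemma rows_mx_mul (m n p : nat) (f : 'I_m -> 'I_n -> 'cV[R]_p) (u : 'cV[R]_p)
    j k :
  (rows_mx f *m u) (mxvec_index k j) 0 = ((f j k)^T *m u) 0 0.
Proof.
by rewrite !mxE; apply: eq_bigr => l _; rewrite rows_mxE [_^T _ _]mxE.
Qed.

Lemma table_eqP (m n : nat) (v w : 'cV[R]_(n * m)) :
  (forall j k, v (mxvec_index k j) 0 = w (mxvec_index k j) 0) -> v = w.
Proof. by move=> vw; apply/colP => i; case/mxvec_indexP: i => k j. Qed.

Lemma tr_mul_colE (N m p : nat) (A : 'M[R]_(N, m)) (X : 'M[R]_(N, p)) i l :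
  (A^T *m X) i l = ((col i A)^T *m X) 0 l.
Proof. by rewrite !mxE; apply: eq_bigr => s _; rewrite !mxE. Qed.

Lemma tr_Bmx_mul (J K p : nat) (f : 'I_J.+1 -> 'I_K.+1 -> 'cV[R]_p) :
  (Bmx R J K)^T *m rows_mx f =
  \matrix_(k, l) (f ord0 (lift ord0 k) - f ord0 ord0) l 0.
Proof.
apply/matrixP => k l; rewrite tr_mul_colE.
have -> : col k (Bmx R J K) = e_ R ord0 (lift ord0 k) - e_ R ord0 ord0.
  by apply/colP => i; rewrite 2!mxE.
by rewrite linearB/= mulmxBl !tr_e_mul -linearB/= !mxE.
Qed.

(** The columns of [Cmx] take double differences, which cancel any term depending on j alone or on k
    alone. *)
Lemma tr_Cmx_mul (J K p : nat) (f : 'I_J.+1 -> 'I_K.+1 -> 'cV[R]_p) :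
  (Cmx R J K)^T *m rows_mx f =
  rows_mx (fun j k => f (lift ord0 j) (lift ord0 k) + f ord0 ord0
                      - f (lift ord0 j) ord0 - f ord0 (lift ord0 k)).
Proof.
apply/matrixP => i l; case/mxvec_indexP: i => k j; rewrite tr_mul_colE rows_mxE.
have -> : col (mxvec_index k j) (Cmx R J K) = c_ R j k.
  by apply/colP => i; rewrite 2!mxE vecE mxE.
by rewrite /c_ !(linearB, linearD)/= !(mulmxBl, mulmxDl) !tr_e_mul !mxE.
Qed.
End TableContrasts.

(** * Reduction of [Sigma_lambda] to an inverse Gram matrix *)

Section Sigma.
Variables (R : realType) (J K L : nat) (z : 'I_J.+1 -> 'I_K.+1 -> 'cV[R]_L).
Hypotheses (hz_col : forall j, z j ord0 = 0) (hz_row : forall k, z ord0 k = 0).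
Hypothesis hZ : \rank (Zo z) = L.

(** Full column rank gives [Zo] a left inverse, so its Gram matrix for the identity form is
    invertible. *)
Lemma Zo_minusK : Zo_minus z *m Zo z = 1%:M.
Proof.
rewrite /Zo_minus -mulmxA mulVmx//.
have /row_freeP[W ZW] : row_free (Zo z)^T by rewrite /row_free mxrank_tr hZ.
have := @gram_unitmx _ _ 1%:M _ _ (Zo z); rewrite mulmx1; apply.
  by rewrite -diag_const_mx; apply: diag_mx_definite => i; rewrite mxE.
move=> u Zu; rewrite -[u]mul1mx -trmx1 -ZW trmx_mul trmxK -mulmxA Zu mulmx0 //.
Qed.

(** The left factor of [Sigma_lambda], hence the transpose of the matrix called W in the
    overview. *)
Let W := col_mx (Bmx R J K)^T (Zo_minus z *m (Cmx R J K)^T).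

Lemma covariate0 j : covariate z j ord0 = 0.
Proof.
rewrite /covariate hz_col -[RHS]col_mx0; congr col_mx; apply/colP => i.
by rewrite !mxE.
Qed.

Lemma covariate_lift j k :
  covariate z j (lift ord0 k) = col_mx (delta_mx k 0) (z j (lift ord0 k)).
Proof.
congr col_mx; apply/colP => i.
by rewrite !mxE (inj_eq lift_inj) eqxx andbT eq_sym.
Qed.

(** The shift [c j] is arbitrary because all contrasts are taken within rows. This covers both the
    raw and the centered covariates. *)
Lemma contrast_covariate (c : 'I_J.+1 -> 'cV[R]_(K + L)) :
  W *m rows_mx (fun j k => covariate z j k - c j) = 1%:M.
Proof.
rewrite /W mul_col_mx -mulmxA tr_Bmx_mul tr_Cmx_mul.
(* The contrasts of [Bmx] live in table row 0, where z vanishes, so only the indicator of the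
   category survives. *)
rewrite (_ : \matrix_(k, l) _ = row_mx 1%:M 0); last first.
  apply/matrixP => k l; rewrite [LHS]mxE opprB addrA subrK covariate0 subr0.
  rewrite covariate_lift hz_row; case: (split_ordP l) => l' ->.
    by rewrite row_mxEl col_mxEu !mxE eqxx andbT eq_sym.
  by rewrite row_mxEr col_mxEd !mxE.
(* The double difference cancels the category indicators and leaves z_jk, since z is zero on the
   border of the table. *)
rewrite (_ : rows_mx _ = row_mx 0 (Zo z)); last first.
  apply/matrixP => i l; case/mxvec_indexP: i => k j; rewrite rows_mxE.
  rewrite !covariate0 !sub0r opprK opprB addrA.
  rewrite [X in X + _ - _]addrAC subrK subrK.
  rewrite !covariate_lift hz_row opp_col_mx add_col_mx subrr subr0.
  case: (split_ordP l) => l' ->; first by rewrite row_mxEl col_mxEu !mxE.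
  by rewrite row_mxEr col_mxEd [RHS]rows_mxE.
by rewrite mul_mx_row mulmx0 Zo_minusK [RHS]scalar_mx_block.
Qed.

Variables (n : 'I_J.+1 -> nat) (q : 'I_J.+1 -> 'I_K.+1 -> R).
Hypotheses (hn : forall j, (1 <= n j)%N) (q_gt0 : forall j k, 0 < q j k).
Hypothesis q_sum : forall j, \sum_k q j k = 1.

Let mu := \matrix_(j < J.+1, k < K.+1) ((n j)%:R * q j k).
Let D := diag_mx (vec mu)^T.
(* The columns of [E] are the [e_row j]. *)
Let E := rows_mx (fun (j : 'I_J.+1) (k : 'I_K.+1) =>
  delta_mx j 0 : 'cV[R]_J.+1).

(** The vector g_jk of the overview: the deviation of a_jk from its mean in row j. *)
Definition centered_covariate j k :=
  covariate z j k - \sum_l q j l *: covariate z j l.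

Let G := rows_mx centered_covariate.

Let D_def : forall v : 'cV[R]__, v^T *m D *m v = 0 -> v = 0.
Proof.
apply: diag_mx_definite => i; case/mxvec_indexP: i => k j.
by rewrite mxE vecE mxE mulr_gt0// ltr0n.
Qed.

(** Deviations from a mean average to zero. This yields both the [D]-orthogonality of [E] and [G]
    and the centering of the score. *)
Lemma sum_centered_covariate j : \sum_k q j k *: centered_covariate j k = 0.
Proof.
under eq_bigr do rewrite scalerBr.
by rewrite sumrB -scaler_suml q_sum scale1r subrr.
Qed.

Let E_mul (u : 'cV[R]_J.+1) j k : (E *m u) (mxvec_index k j) 0 = u j 0.
Proof. by rewrite rows_mx_mul trmx_delta -rowE mxE. Qed.

Let EG : E^T *m D *m G = 0.
Proof.
rewrite rows_mx_gram big1// => j _.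
have muE k : mu j k *: (delta_mx j 0 *m (centered_covariate j k)^T) =
    (n j)%:R *: (delta_mx j 0 *m (q j k *: centered_covariate j k)^T).
  by rewrite mxE -scalerA scalemxAr [(q j k *: _)^T]linearZ.
rewrite (eq_bigr _ (fun k _ => muE k)) -scaler_sumr -mulmx_sumr -linear_sum/=.
by rewrite sum_centered_covariate linear0 mulmx0 scaler0.
Qed.

Let GE : G^T *m D *m E = 0.
Proof.
rewrite rows_mx_gram big1// => j _.
under eq_bigr do rewrite mxE -scalerA scalemxAl.
by rewrite -scaler_sumr -mulmx_suml sum_centered_covariate mul0mx scaler0.
Qed.

Let ED_unit : E^T *m D *m E \in unitmx.
Proof.
apply: gram_unitmx => // u /matrixP Eu; apply/colP => j.
by have := Eu (mxvec_index ord0 j) 0; rewrite E_mul !mxE.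
Qed.

(** By [contrast_covariate], [G] has a left inverse and is therefore injective. *)
Let GD_unit : G^T *m D *m G \in unitmx.
Proof.
apply: gram_unitmx => // u Gu.
by rewrite -[u]mul1mx
  -(contrast_covariate (fun j => \sum_l q j l *: covariate z j l))
  -mulmxA Gu mulmx0.
Qed.

Lemma RspaceE : @Rspace R J K = [set v | exists u, v = E *m u].
Proof.
have e_rowE j : e_row R K j = E *m delta_mx j 0.
  apply: table_eqP => j' k'; rewrite E_mul /e_row summxE (bigD1 k')//= big1.
    by rewrite addr0 vecE !mxE eqxx.
  by move=> k kk'; rewrite vecE mxE andbC eq_sym (negbTE kk').
apply/seteqP; split=> v /=.
  (* Seen as the image of a linear map, the range of [E] contains the span as soon as it contains
     the generators. *)
  have /subvP RE : (<<[seq e_row R K j | j : 'I_J.+1]>> <=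
      limg (linfun (mulmx E : 'cV[R]_J.+1 -> 'cV[R]_(K.+1 * J.+1))))%VS.
    apply/span_subvP => w /mapP[j _ ->]; rewrite e_rowE.
    by rewrite -[E *m _](lfunE (mulmx E)) memv_img ?memvf.
  by move=> /RE/memv_imgP[u _ ->]; exists u; rewrite lfunE.
case=> u ->; have -> : E *m u = \sum_j u j 0 *: e_row R K j.
  under eq_bigr do rewrite e_rowE scalemxAr.
  rewrite -mulmx_sumr; congr (_ *m _).
  by rewrite [LHS]matrix_sum_delta; apply: eq_bigr => j _; rewrite big_ord1.
by apply: memv_suml => j _; rewrite memvZ// memv_span// map_f// mem_enum.
Qed.

(** Centering the covariates changes a table only by row constants, and alpha + rho_j already ranges
    over all row constants. *)
Lemma HspaceE : Hspace z = [set v | exists u w, v = E *m u + G *m w].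
Proof.
have GE' (w : 'cV[R]_(K + L)) j k : (G *m w) (mxvec_index k j) 0 =
   logit z w j k - \sum_l q j l * logit z w j l.
  rewrite rows_mx_mul linearB/= mulmxBl mxE; congr (_ + _).
  rewrite mxE; congr (- _); rewrite linear_sum/= mulmx_suml summxE.
  by apply: eq_bigr => l _; rewrite linearZ/= -scalemxAl mxE.
apply/seteqP; split=> v /=.
  move=> [alpha [rho [gamma [theta [rho0 gamma0 ->]]]]].
  pose w : 'cV[R]_(K + L) := col_mx (\col_i gamma (lift ord0 i)) theta.
  (* The row effect restores the mean logit that [G] subtracts. *)
  exists (\col_j (alpha + rho j + \sum_l q j l * logit z w j l)), w.
  apply: table_eqP => j k; rewrite vecE mxE [RHS]mxE E_mul.
  rewrite GE' [(\col_j _) _ _]mxE.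
  rewrite addrACA subrr addr0 -addrA; congr (_ + _).
  have [i ->|->] := unliftP ord0 k; last first.
    by rewrite gamma0 logit0// hz_col trmx0 mul0mx mxE addr0.
  by rewrite logit_lift /w col_mxKu col_mxKd [(\col__ _) _ _]mxE.
move=> [u [w ->]].
(* The total constant of row j. Its value in row 0 serves as alpha, which forces rho_0 = 0; the
   default 0 below is the constraint gamma_0 = 0. *)
pose a j := u j 0 - \sum_l q j l * logit z w j l.
exists (a ord0), (fun j => a j - a ord0),
  (fun k => if unlift ord0 k is Some i then usubmx w i 0 else 0), (dsubmx w).
split; [exact: subrr| by rewrite unlift_none |apply/esym].
apply: table_eqP => j k; rewrite vecE mxE [RHS]mxE E_mul GE' addrCA subrr addr0.
rewrite [RHS]addrCA [RHS]addrC -[RHS]/(a j + logit z w j k) -[LHS]addrA.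
congr (_ + _).
have [i ->|->] := unliftP ord0 k; last first.
  by rewrite logit0// hz_col trmx0 mul0mx mxE addr0.
by rewrite logit_lift.
Qed.

Lemma Sigma_lambdaE :
  G^T *m D *m G \in unitmx /\ invmx (G^T *m D *m G) = Sigma_lambda z mu.
Proof.
split=> //; rewrite /Sigma_lambda -/D.
(* [D] is the Gram matrix of the identity. *)
have D_unit : D \in unitmx.
  have := @gram_unitmx _ _ D D_def _ 1%:M; rewrite trmx1 mul1mx mulmx1; apply.
  by move=> u; rewrite mul1mx.
have -> : orth_proj D (Hspace z) = proj_mx D E + proj_mx D G.
  by apply: orth_projE => //; rewrite HspaceE; exact: is_orth_proj_add.
have -> : orth_proj D (@Rspace R J K) = proj_mx D E.
  by apply: orth_projE => //; rewrite RspaceE; exact: is_orth_proj_proj_mx.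
(* Only the projection onto the columns of [G] remains; its outer factors [G] and [G^T] are
   cancelled by [W] and [W^T], and its [D] by the inverse of [D]. *)
rewrite addrAC subrr add0r /proj_mx.
have WG : W *m G = 1%:M by exact: contrast_covariate.
have GW : G^T *m row_mx (Bmx R J K) (Cmx R J K *m (Zo_minus z)^T) = 1%:M.
  by rewrite -trmx1 -WG [(W *m G)^T]trmx_mul /W tr_col_mx
    [(_ *m (Cmx R J K)^T)^T]trmx_mul !trmxK.
by rewrite -/W !mulmxA WG mul1mx mulmxK// -[_ *m G^T *m _]mulmxA GW mulmx1.
Qed.
End Sigma.

(** * Covariances of simple functions of independent observations *)

Section SimpleFunctions.
Context (R : realType) (d : measure_display) (T : measurableType d).
Variables (P : probability T R) (I : finType) (E : I -> set T).
Hypothesis mE : forall t, measurable (E t).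

Lemma expectation_simple (a : I -> R) :
  ('E_P[fun w => (\sum_t a t * \1_(E t) w)%R])%E =
  (\sum_t a t * fine (P (E t)))%:E.
Proof.
rewrite unlock -sumEFin.
under eq_integral do rewrite -sumEFin.
have iE t : P.-integrable setT (fun w => (\1_(E t) w)%:E).
  exact: integrable_indic.
rewrite integral_sum//=; last first.
  by move=> t; under eq_fun do rewrite EFinM; exact: integrableZl.
apply: eq_bigr => t _; under eq_integral do rewrite EFinM.
by rewrite integralZl//= integral_indic// setIT EFinM fineK// fin_num_measure.
Qed.
End SimpleFunctions.

(** Both functions have mean zero, so the covariance is the expectation of the product, and products
    of indicators are indicators of intersections. *)
Lemma covariance_simple (R : realType) (d : measure_display)
    (T : measurableType d) (P : probability T R) (I : finType) (E : I -> set T)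
    (a b : I -> R) :
  (forall t, measurable (E t)) ->
  \sum_t a t * fine (P (E t)) = 0 -> \sum_t b t * fine (P (E t)) = 0 ->
  covariance P (fun w => \sum_t a t * \1_(E t) w)
    (fun w => \sum_t b t * \1_(E t) w) =
  (\sum_s \sum_t a s * b t * fine (P (E s `&` E t)))%:E.
Proof.
move=> mE a0 b0; rewrite unlock !expectation_simple// a0 b0.
rewrite pair_big/=.
rewrite -(@expectation_simple _ _ _ _ _ (fun u : I * I => E u.1 `&` E u.2));
  last first.
  by move=> u; exact: measurableI.
congr ('E_P [_])%E; apply/funext => w /=.
rewrite mulrfctE /= !subr0 big_distrlr pair_big/=.
by apply: eq_bigr => u _; rewrite indicI/= mulrACA.
Qed.

Lemma mutually_independent_pair (R : realType) (d dU : measure_display)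
    (T : measurableType d) (U : measurableType dU) (P : probability T R)
    (I : finType) (Y : I -> T -> U) (s t : I) (A B : set U) :
  mutually_independent P Y -> s != t -> measurable A -> measurable B ->
  (P (Y s @^-1` A `&` Y t @^-1` B) = P (Y s @^-1` A) * P (Y t @^-1` B))%E.
Proof.
move=> indep st mA mB.
have ts : (t == s) = false by rewrite eq_sym (negbTE st).
have mAB i : measurable (if i == s then A else B) by case: ifP.
(* Independence is used for the pair {s, t} and the family with [A] at s and [B] elsewhere. *)
have := indep [set s; t]%SET (fun i => if i == s then A else B) mAB.
rewrite big_setU1 ?inE//= big_set1 eqxx ts => <-; congr (P _).
apply/seteqP; split=> w.
  by move=> [ws wt] i /=; rewrite !inE => /orP[]/eqP->; rewrite ?eqxx ?ts.
move=> h; split; first by have := h s; rewrite eqxx;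
  apply; rewrite /= !inE eqxx.
by have := h t; rewrite ts; apply; rewrite /= !inE eqxx orbT.
Qed.

Section IndependentSample.
Context (R : realType) (d dU : measure_display) (T : measurableType d)
  (U : measurableType dU).
Variables (P : probability T R) (S C : finType) (Y : S -> {mfun T >-> U}).
Variables (y : C -> U) (p : S -> C -> R).
Hypotheses (y_inj : injective y) (y_meas : forall k, measurable [set y k]).
Hypothesis Y_law : forall s k, P (Y s @^-1` [set y k]) = (p s k)%:E.
Hypothesis Y_indep : mutually_independent P (fun s => Y s : T -> U).

(** Cross terms of distinct observations factor by independence into a product of two zero means.
    Within one observation, distinct categories are disjoint events because [y] is injective, so
    only the diagonal is left. *)
Lemma covariance_independent_sample (a b : S -> C -> R) :
  (forall s, \sum_k a s k * p s k = 0) ->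
  (forall s, \sum_k b s k * p s k = 0) ->
  covariance P
    (fun w => \sum_(t : S * C) a t.1 t.2 * \1_(Y t.1 @^-1` [set y t.2]) w)
    (fun w => \sum_(t : S * C) b t.1 t.2 * \1_(Y t.1 @^-1` [set y t.2]) w) =
  (\sum_s \sum_k a s k * b s k * p s k)%:E.
Proof.
move=> a0 b0.
pose E (t : S * C) := Y t.1 @^-1` [set y t.2].
have mE t : measurable (E t) by exact: measurable_funPTI.
have centered (c : S -> C -> R) : (forall s, \sum_k c s k * p s k = 0) ->
    \sum_(t : S * C) c t.1 t.2 * fine (P (E t)) = 0.
  move=> c0.
  rewrite -(pair_big predT predT (fun s k => c s k * fine (P (E (s, k)))))/=.
  by apply: big1 => s _; rewrite -[RHS](c0 s); apply: eq_bigr => k _;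
    rewrite Y_law.
rewrite (covariance_simple (E := E) (a := fun t => a t.1 t.2)
  (b := fun t => b t.1 t.2)) ?centered//.
congr (_%:E).
rewrite -(pair_big predT predT (fun s k =>
  \sum_t a s k * b t.1 t.2 * fine (P (E (s, k) `&` E t))))/=.
apply: eq_bigr => s _.
under eq_bigr => k _ do
  rewrite -(pair_big predT predT (fun s' k' =>
    a s k * b s' k' * fine (P (E (s, k) `&` E (s', k')))))/=.
rewrite exchange_big (bigD1 s)//= [X in _ + X]big1 ?addr0 => [|s' s's].
  apply: eq_bigr => k _; rewrite (bigD1 k)//= big1 ?addr0 => [|k' kk'].
    by rewrite setIid Y_law.
  rewrite (_ : _ `&` _ = set0) ?measure0 ?mulr0//.
  apply/seteqP; split=> // w []; rewrite /E/= => -> /y_inj kk.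
  by rewrite kk eqxx in kk'.
transitivity ((\sum_k a s k * p s k) * (\sum_k b s' k * p s' k)); last first.
  by rewrite b0 mulr0.
rewrite big_distrlr/=.
apply: eq_bigr => k _; apply: eq_bigr => k' _.
rewrite (mutually_independent_pair Y_indep) 1?eq_sym// !Y_law/=.
by rewrite mulrACA.
Qed.
End IndependentSample.

Lemma countsE (R : realType) (T U : Type) (J K : nat) (n : 'I_J.+1 -> nat)
    (y : 'I_K.+1 -> U) (Ys : forall j : 'I_J.+1, 'I_(n j) -> T -> U) (w : T)
    j k :
  (counts y Ys w j k)%:R =
  \sum_(i < n j) \1_(Ys j i @^-1` [set y k]) w :> R.
Proof.
rewrite /counts -sum1_card natr_sum big_mkcond/=; apply: eq_bigr => i _.
rewrite indicE (_ : (i \in _) = (w \in Ys j i @^-1` [set y k])).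
  by case: ifP.
exact: asboolb.
Qed.

(** * The covariance of the score and its inverse *)

Theorem theorem4 (R : realType) (J K L p : nat)
    (hJ : (1 <= J)%N) (hK : (1 <= K)%N)
    (* X, Y and the conditional distribution of Y given X *)
    (d0 dU : measure_display) (T0 : measurableType d0) (U : measurableType dU)
    (P0 : probability T0 R)
    (X : {mfun T0 >-> p.-tuple R}) (Y : {mfun T0 >-> U})
    (y : 'I_K.+1 -> U) (hY : has_finite_support P0 Y y)
    (kappa : R.-pker (p.-tuple R) ~> U)
    (hkappa : cond_distribution P0 X Y kappa)
    (hkappa_supp : forall t : p.-tuple R, kappa t (range y) = 1%E)
    (x : 'I_J.+1 -> p.-tuple R) (hx : injective x)
    (hxsupp : forall j, in_support P0 X (x j))
    (* the samples *)
    (d : measure_display) (T : measurableType d) (P : probability T R)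
    (n : 'I_J.+1 -> nat) (hn : forall j, (1 <= n j)%N)
    (Ys : forall j : 'I_J.+1, 'I_(n j) -> {mfun T >-> U})
    (hYs_law : forall (j : 'I_J.+1) (i : 'I_(n j)) (B : set U),
      measurable B -> P (Ys j i @^-1` B) = kappa (x j) B)
    (hYs_indep : mutually_independent P
      (fun s : {j : 'I_J.+1 & 'I_(n j)} => Ys (tag s) (tagged s) : T -> U))
    (* the model *)
    (z : 'I_J.+1 -> 'I_K.+1 -> 'cV[R]_L)
    (hz_col : forall j, z j ord0 = 0) (hz_row : forall k, z ord0 k = 0)
    (hZ : \rank (Zo z) = L)
    (pi : 'cV[R]_(K + L) -> 'I_J.+1 -> 'I_K.+1 -> R)
    (hpi : logit_model z pi)
    (lambda : 'cV[R]_(K + L))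
    (hlambda : forall j k, kappa (x j) [set y k] = (pi lambda j k)%:E) :
  let mu := \matrix_(j < J.+1, k < K.+1) ((n j)%:R * pi lambda j k) in
  let score := fun w : T =>
    gradient (log_lik pi (counts y (fun j i => Ys j i : T -> U) w)) lambda in
  cov_mx P score \in unitmx /\
  invmx (cov_mx P score) = Sigma_lambda z mu.
Proof.
move=> mu score.
have [y_inj y_meas _ _] := hY.
pose q := pi lambda.
have q_gt0 j k : 0 < q j k by have [] := hpi lambda j.
have q_sum j : \sum_k q j k = 1 by have [] := hpi lambda j.
pose g := centered_covariate z q.
have [] := Sigma_lambdaE hz_col hz_row hZ hn q_gt0 q_sum.
(* It remains to identify the covariance with the Gram matrix of the centered covariates. *)
suff -> : cov_mx P score =
    (rows_mx g)^T *m diag_mx (vec mu)^T *m rows_mx g by [].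
rewrite rows_mx_gram.
pose S := {j : 'I_J.+1 & 'I_(n j)}.
(* Expanding the counts into indicators makes each score component a simple function, indexed by
   single observations (group and position) and categories. *)
have scoreE m : (fun w => score w m ord0) = fun w =>
    \sum_(t : S * 'I_K.+1) g (tag t.1) t.2 m 0 *
      \1_(Ys (tag t.1) (tagged t.1) @^-1` [set y t.2]) w.
  apply/funext => w; rewrite /score (gradient_log_lik hpi hz_col) summxE.
  rewrite -(pair_big predT predT (fun (s : S) k => g (tag s) k m 0 *
      \1_(Ys (tag s) (tagged s) @^-1` [set y k]) w))/=.
  rewrite -(sig_big_dep (fun _ => true) (fun _ _ => true)
    (fun j (i : 'I_(n j)) =>
     \sum_k g j k m 0 * \1_(Ys j i @^-1` [set y k]) w))/=.
  apply: eq_bigr => j _; rewrite summxE exchange_big/=; apply: eq_bigr => k _.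
  by rewrite mxE countsE mulr_suml; apply: eq_bigr => i _; rewrite mulrC.
apply/matrixP => m m'; rewrite mxE !scoreE.
have centered l (s : S) : \sum_k g (tag s) k l 0 * q (tag s) k = 0.
  have /matrixP/(_ l 0) := sum_centered_covariate z q_sum (tag s).
  rewrite summxE [RHS]mxE => gq0; rewrite -[RHS]gq0; apply: eq_bigr => k _.
  by rewrite [RHS]mxE mulrC.
have law (s : S) k : P (Ys (tag s) (tagged s) @^-1` [set y k]) =
    (q (tag s) k)%:E.
  by rewrite hYs_law// hlambda.
rewrite (covariance_independent_sample (Y := fun s : S => Ys (tag s) (tagged s))
  y_inj y_meas law hYs_indep (centered m) (centered m'))/=.
rewrite -(sig_big_dep (fun _ => true) (fun _ _ => true)
    (fun j (i : 'I_(n j)) =>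
   \sum_k g j k m 0 * g j k m' 0 * q j k))/= summxE.
(* The [n j] observations of group j contribute equally, which turns the weight [q j k] into
   [mu j k]. *)
apply: eq_bigr => j _; rewrite sumr_const card_ord summxE -sumrMnl.
apply: eq_bigr => k _; rewrite -mulr_natl [RHS]mxE [mu j k]mxE -[RHS]mulrA.
congr (_ * _); rewrite mulrC; congr (_ * _).
by rewrite [RHS]mxE big_ord1 [_^T _ _]mxE.
Qed.
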